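(* Let $((X_i,Y_i))_{i=1,2,\ldots}$ be a stationary ergodic time series with values in $\mathbb{R}^{p}\times\mathbb{R}^{q}=\mathbb{R}^{p+q}$ and generic element $(X,Y)$, and let $\mu$ be a Borel measure on $\mathbb{R}^{p+q}$ that is finite on the sets $\{(s,t):|s|\wedge|t|>\delta\}$, $\delta>0$. Assume that one of the following three conditions holds: (1) $\mu$ is a finite measure on $\mathbb{R}^{p+q}$. (2) $\mu$ is an infinite measure on $\mathbb{R}^{p+q}$, finite on the sets $\{(s,t):|s|\wedge|t|>\delta\}$, $\delta>0$, such that for some $\alpha\in(0,2]$, $\int_{\mathbb{R}^{p+q}}(1\wedge|s|^\alpha)(1\wedge|t|^\alpha)\,\mu(ds,dt)<\infty$ and $\mathbb{E}[|X|^\alpha]+\mathbb{E}[|Y|^\alpha]<\infty$. (3) $\mu$ is infinite in a neighborhood of the origin and for some $\alpha\in(0,2]$, $\mathbb{E}[|X|^\alpha]+\mathbb{E}[|Y|^\alpha]<\infty$ and $\int_{\mathbb{R}^{p+q}}1\wedge|(s,t)|^{\alpha}\,\mu(ds,dt)<\infty$. Then $$T_n(X,Y;\mu)\to T(X,Y;\mu)\quad\text{almost surely as } n\to\infty .$$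
   Context: $|\cdot|$ is the Euclidean norm, $(s,t)$ with $s\in\mathbb{R}^p,t\in\mathbb{R}^q$ is the concatenated vector with $|(s,t)|=\sqrt{|s|^2+|t|^2}$. For a random vector $Z$, $\varphi_Z(t)=\mathbb{E}[e^{i\langle t,Z\rangle}]$ is its characteristic function, and $\varphi_{X,Y}(s,t)=\mathbb{E}[e^{i\langle s,X\rangle+i\langle t,Y\rangle}]$. Distance covariance: $T(X,Y;\mu)=\int_{\mathbb{R}^{p+q}}|\varphi_{X,Y}(s,t)-\varphi_X(s)\varphi_Y(t)|^2\,\mu(ds,dt)$. Empirical distance covariance: $T_n(X,Y;\mu)=\int_{\mathbb{R}^{p+q}}|\varphi^n_{X,Y}(s,t)-\varphi^n_X(s)\varphi^n_Y(t)|^2\,\mu(ds,dt)$, where $\varphi^n_{X,Y}(s,t)=\frac1n\sum_{j=1}^n e^{i\langle s,X_j\rangle+i\langle t,Y_j\rangle}$, $\varphi^n_X(s)=\varphi^n_{X,Y}(s,0)$, $\varphi^n_Y(t)=\varphi^n_{X,Y}(0,t)$. *)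

(* Defs.v *)
From mathcomp Require Import all_boot all_order all_algebra.
From mathcomp Require Import complex.
From mathcomp Require Import all_classical all_reals all_analysis.

Set Implicit Arguments.
Unset Strict Implicit.
Unset Printing Implicit Defensive.

Import Order.TTheory GRing.Theory Num.Theory.
Import numFieldNormedType.Exports.

Local Open Scope classical_set_scope.
Local Open Scope ring_scope.

(* R^n with its Borel sigma-algebra. The carrier is convertible to 'rV[R]_n. *)
Definition borelRn (R : realType) (n : nat) :
    measurableType (@open 'rV[R]_n).-sigma :=
  g_sigma_algebraType (@open 'rV[R]_n).

Section euclidean.
Context {R : realType}.

Definition dotv (n : nat) (s t : 'rV[R]_n) : R := \sum_(i < n) s 0 i * t 0 i.

(* The library's norm on 'rV[R]_n is the sup norm. *)
Definition enorm (n : nat) (s : 'rV[R]_n) : R :=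
  Num.sqrt (\sum_(i < n) s 0 i ^+ 2).

End euclidean.

Section characteristic_functions.
Context {R : realType}.

Definition expi (x : R) : R[i] := Complex (cos x) (sin x).

(* 'E_P is only available for real-valued functions; fine is harmless here
   because this is only applied to functions of modulus 1. *)
Definition Cexpectation (d : measure_display) (T : measurableType d)
    (P : probability T R) (f : T -> R[i]) : R[i] :=
  Complex (fine 'E_P[fun w => complex.Re (f w)])
          (fine 'E_P[fun w => complex.Im (f w)]).

Definition charf (d : measure_display) (T : measurableType d)
    (P : probability T R) (n : nat) (Z : T -> 'rV[R]_n) (t : 'rV[R]_n) : R[i] :=
  Cexpectation P (fun w => expi (dotv t (Z w))).

Definition joint_charf (d : measure_display) (T : measurableType d)
    (P : probability T R) (p q : nat) (X : T -> 'rV[R]_p) (Y : T -> 'rV[R]_q)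
    (s : 'rV[R]_p) (t : 'rV[R]_q) : R[i] :=
  Cexpectation P (fun w => expi (dotv s (X w) + dotv t (Y w))).

(* The observations (X_1, Y_1), ..., (X_n, Y_n) are (x 0, y 0), ...,
   (x n.-1, y n.-1). *)
Definition emp_joint_charf (p q n : nat)
    (x : nat -> 'rV[R]_p) (y : nat -> 'rV[R]_q)
    (s : 'rV[R]_p) (t : 'rV[R]_q) : R[i] :=
  n%:R^-1 * \sum_(j < n) expi (dotv s (x j) + dotv t (y j)).

End characteristic_functions.

Section distance_covariance.
Context {R : realType} {p q : nat}.
Variable mu : {measure set (borelRn R (p + q)) -> \bar R}.

Definition dcov (d : measure_display) (T : measurableType d)
    (P : probability T R) (X : T -> 'rV[R]_p) (Y : T -> 'rV[R]_q) : \bar R :=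
  (\int[mu]_st
    ((ComplexField.Normc.normc
       (joint_charf P X Y (lsubmx st) (rsubmx st)
        - charf P X (lsubmx st) * charf P Y (rsubmx st)) ^+ 2)%R)%:E)%E.

Definition emp_dcov (n : nat) (x : nat -> 'rV[R]_p) (y : nat -> 'rV[R]_q) :
    \bar R :=
  (\int[mu]_st
    ((ComplexField.Normc.normc
       (emp_joint_charf n x y (lsubmx st) (rsubmx st)
        - emp_joint_charf n x y (lsubmx st) 0
          * emp_joint_charf n x y 0 (rsubmx st)) ^+ 2)%R)%:E)%E.

End distance_covariance.

Section stationary_ergodic.
Context {R : realType} (d d' : measure_display) (T : measurableType d)
  (E : measurableType d').

(* The product sigma-algebra on the path space E^nat. *)
Definition path_measurable : set (set (nat -> E)) :=
  <<s \bigcup_(i in [set: nat])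
        preimage_set_system setT (fun x : nat -> E => x i) measurable >>.

Definition shift (h : nat) (x : nat -> E) : nat -> E := fun i => x (i + h)%N.

Definition sample_path (Z : nat -> T -> E) (w : T) : nat -> E := fun i => Z i w.

Definition stationary (P : probability T R) (Z : nat -> T -> E) : Prop :=
  forall (h : nat) (A : set (nat -> E)), path_measurable A ->
    P [set w | A (shift h (sample_path Z w))] =
    P [set w | A (sample_path Z w)].

Definition ergodic (P : probability T R) (Z : nat -> T -> E) : Prop :=
  forall A : set (nat -> E), path_measurable A -> shift 1 @^-1` A = A ->
    P [set w | A (sample_path Z w)] = 0%E \/
    P [set w | A (sample_path Z w)] = 1%E.

Definition same_law (P : probability T R) (U V : T -> E) : Prop :=
  forall B : set E, measurable B -> P (U @^-1` B) = P (V @^-1` B).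

End stationary_ergodic.

(* Main.v *)
From HB Require Import structures.
From Pilot Require Import Defs.
From mathcomp Require Import all_boot all_order all_algebra.
From mathcomp Require Import complex.
From mathcomp Require Import all_classical all_reals all_analysis.
From mathcomp Require Import measurable_realfun.
From mathcomp Require Import ring lra.

(* Almost surely the empirical characteristic function converges at every point
   simultaneously: Birkhoff's theorem gives the rational points, and averages of
   min(2, |Z_j|_1 / (m + 1)) control the oscillation between a point and a
   nearby rational one.  For a fixed path, T_n -> T is then dominated
   convergence with respect to mu.  The dominating function comes from centering
   both exponentials at 1 and the Cauchy-Schwarz inequality:
     |phi^n_{X,Y} - phi^n_X phi^n_Y|^2
       <= 4 (1/n sum_j |e^{i<s,X_j>} - 1|^2) (1/n sum_j |e^{i<t,Y_j>} - 1|^2),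
   where |e^{i<s,x>} - 1|^2 <= 4 min(1, |s|^alpha) (1 + |x|^alpha) and the
   empirical alpha-moments stay bounded, again by Birkhoff's theorem. In
   condition (3) one uses that min(1, |s|^alpha) min(1, |t|^alpha) is at most
   min(1, |(s,t)|^alpha). *)

Set Implicit Arguments.
Unset Strict Implicit.
Unset Printing Implicit Defensive.

Import Order.TTheory GRing.Theory Num.Theory.
Import numFieldNormedType.Exports.

Local Open Scope classical_set_scope.
Local Open Scope ring_scope.

(** * Birkhoff's pointwise ergodic theorem *)

Section pointwise_ergodic_theorem.
Context {d : measure_display} {T : measurableType d} {R : realType}.
Context (P : probability T R) (th : {mfun T >-> T}).
Hypothesis th_preserving : forall A, measurable A -> P (th @^-1` A) = P A.

(** Preservation says that the image measure of [P] under [th] is [P] itself, so this is a change of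
    variables. *)
Lemma ge0_integral_preserving (f : T -> \bar R) :
  measurable_fun setT f -> (forall x, 0 <= f x)%E ->
  (\int[P]_x f (th x) = \int[P]_x f x)%E.
Proof.
move=> mf f0; rewrite -(@ge0_integral_distribution _ _ T T R P th)//.
by apply: eq_measure_integral => A mA _; exact: th_preserving.
Qed.

Lemma integrable_preserving (f : T -> R) :
  P.-integrable setT (EFin \o f) -> P.-integrable setT (EFin \o (f \o th)).
Proof.
move=> /integrableP[mf intf]; apply/integrableP; split.
  exact: (measurableT_comp mf).
apply: le_lt_trans intf; rewrite le_eqVlt; apply/orP; left; apply/eqP.
rewrite -[RHS](@ge0_integral_preserving (abse \o (EFin \o f)))//.
  exact: measurableT_comp.
by move=> x; exact: abse_ge0.
Qed.

Lemma Rintegral_preserving (f : T -> R) : measurable_fun setT f ->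
  (forall x, 0 <= f x) -> \int[P]_x f (th x) = \int[P]_x f x.
Proof.
move=> mf f0; congr fine.
apply: (@ge0_integral_preserving (EFin \o f)); first exact/measurable_EFinP.
by move=> x; rewrite lee_fin.
Qed.

(** * Maximal partial sums along an orbit *)

Section maximal_function.
Context (g : T -> R) (ig : P.-integrable setT (EFin \o g)).

(** With S_k the sum of the first k values of [g] along the orbit of [x] and S_0 = 0, this is
    max(S_0, ..., S_n). The recursion splits off the first term of each S_k, which is the form
    needed to compare the values at [x] and at [th x]. *)
Fixpoint max_partial_sum n x : R :=
  if n is m.+1 then Num.max 0 (g x + max_partial_sum m (th x)) else 0.

Local Notation M := max_partial_sum.

Lemma max_partial_sum_ge0 n x : 0 <= M n x.
Proof. by case: n => //= n; rewrite le_max lexx. Qed.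

Lemma partial_sum_le_max n x : \sum_(j < n) g (iter j th x) <= M n x.
Proof.
elim: n x => [|n IH] x; first by rewrite big_ord0.
rewrite big_ord_recl /= le_max; apply/orP; right; rewrite lerD2l.
by apply: le_trans (IH (th x)); under eq_bigr do rewrite -iterS iterSr.
Qed.

Lemma measurable_max_partial_sum n : measurable_fun setT (M n).
Proof.
elim: n => [|n IH]/=; first exact: measurable_cst.
have mg : measurable_fun setT g by move/integrableP: ig => [/measurable_EFinP].
apply: measurable_maxr; first exact: measurable_cst.
by apply: measurable_funD => //; exact: measurableT_comp.
Qed.

(** By induction from 0 <= M_{n+1} <= |g| + M_n o th. *)
Lemma integrable_max_partial_sum n : P.-integrable setT (EFin \o M n).
Proof.
elim: n => [|n IH]/=; first exact: integrable0.
apply: (@le_integrable _ _ _ _ _ _ _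
  ((EFin \o Num.norm \o g) \+ (EFin \o (M n \o th)))%E) => //.
- exact/measurable_EFinP/(measurable_max_partial_sum n.+1).
- move=> x _ /=; rewrite lee_fin ger0_norm ?le_max ?lexx//.
  have M0 := max_partial_sum_ge0 n (th x).
  rewrite ger0_norm ?addr_ge0// ge_max addr_ge0//=.
  by rewrite lerD2r ler_norm.
- apply: integrableD => //; last exact: integrable_preserving.
  exact: integrable_norm.
Qed.

(** The event that the partial sums have supremum +oo. Integer thresholds make it a countable
    intersection of countable unions. *)
Definition unbounded_sums := [set x | forall K : nat, exists n, K%:R < M n x].

Lemma measurable_unbounded_sums : measurable unbounded_sums.
Proof.
rewrite (_ : unbounded_sums = \bigcap_(K : nat) \bigcup_n (M n @^-1` `]K%:R, +oo[)).
  apply: bigcapT_measurable => K; apply: bigcupT_measurable => n.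
  by rewrite -[X in measurable X]setTI; exact: measurable_max_partial_sum.
apply/seteqP; split => [x h K _|x h K].
  by have [n hn] := h K; exists n => //=; rewrite in_itv/= andbT.
by have [n _ /=] := h K I; rewrite in_itv/= andbT; exists n.
Qed.

(** Since M_{n+1}(x) = max(0, g(x) + M_n(th x)), passing from [x] to [th x] changes large values
    only by g(x). Raising the threshold K by |g(x)| absorbs this change. *)
Lemma unbounded_sums_invariant : th @^-1` unbounded_sums = unbounded_sums.
Proof.
apply/seteqP; split => x h K.
  have [n hn] := h (Num.truncn (K%:R + `|g x|)).+1.
  exists n.+1 => /=; rewrite lt_max; apply/orP; right.
  have := truncnS_gt (K%:R + `|g x|) => h1.
  have := ler_norm (- g x); rewrite normrN; lra.
have [n hn] := h (Num.truncn (K%:R + `|g x|)).+1.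
(* As M_0 = 0 cannot exceed the threshold, the index is positive and may be lowered by one. *)
case: n hn => [/=|n /= hn]; first by rewrite ltrn0.
exists n; have h1 := truncnS_gt (K%:R + `|g x|).
move: hn; have := ler_norm (g x); have := max_partial_sum_ge0 n (th x).
have : 0 <= K%:R :> R by [].
have g0 := normr_ge0 (g x).
rewrite lt_max; move=> a b c /orP[]; lra.
Qed.

Lemma max_partial_sum_le n x : M n x <= M n.+1 x.
Proof.
elim: n x => [x|n IH x]; first exact: (max_partial_sum_ge0 1 x).
rewrite [leRHS]/= [leLHS]/= ge_max le_max lexx/= le_max; apply/orP; right.
by rewrite lerD2l.
Qed.

Lemma max_partial_sum_homo x : {homo M ^~ x : m n / (m <= n)%N >-> m <= n}.
Proof. by apply: homo_leq => [//|y z t|n]; [exact: le_trans|exact: max_partial_sum_le]. Qed.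

(* [M n.+1 - M n \o th = max (- M n \o th) g] decreases to [g] on the set where
   the partial sums are unbounded, and has a nonnegative integral. *)
Lemma integral_ge0_of_unbounded_sums :
  P unbounded_sums = 1%E -> 0 <= \int[P]_x g x.
Proof.
move=> P1.
pose h n x := M n.+1 x - M n (th x).
have hE n x : h n x = Num.max (- M n (th x)) (g x).
  by rewrite /h /= !maxEge; case: ifP; case: ifP => a b; lra.
have aeU : {ae P, forall x, unbounded_sums x}.
  exists (~` unbounded_sums); split => //.
    exact/measurableC/measurable_unbounded_sums.
  by rewrite probability_setC ?P1 ?subee//; exact: measurable_unbounded_sums.
have mg : measurable_fun setT g by move/integrableP: ig => [/measurable_EFinP].
have mh n : measurable_fun setT (h n).
  apply: measurable_funB; first exact: measurable_max_partial_sum.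
  by apply: measurableT_comp => //; exact: measurable_max_partial_sum.
(* By invariance the sums are unbounded at [th x] too. Once M_n(th x) exceeds |g(x)|, the maximum in
   [hE] equals g(x), so the sequence is eventually constant. *)
have h_cvg : {ae P, forall x, setT x -> EFin (h n x) @[n --> \oo] --> EFin (g x)}.
  apply: filterS aeU => x; rewrite -{1}unbounded_sums_invariant => Ux _.
  have [n0 hn0] := Ux (Num.truncn `|g x|).+1.
  apply: cvg_near_cst; exists n0 => // n /= n0n; congr EFin; rewrite hE.
  apply: max_r; have := max_partial_sum_homo (th x) n0n; move: hn0.
  have := truncnS_gt `|g x|; have := ler_norm (- g x); rewrite normrN; lra.
(* If the maximum is -M_n(th x), then g(x) < -M_n(th x) <= 0, so its absolute value is still at most
   |g(x)|. *)
have h_bound : {ae P, forall x n, setT x -> (`|(h n x)%:E| <= `|g x|%:E)%E}.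
  apply: aeW => x n _; rewrite lee_fin hE.
  have := max_partial_sum_ge0 n (th x); rewrite maxEge; case: ifP => //.
  move=> gM M0.
  by rewrite !ler0_norm; lra.
have [_ _ cv] := dominated_convergence measurableT
  (fun n => (measurable_EFinP _ _).2 (mh n)) ((measurable_EFinP _ _).2 mg)
  h_cvg (integrable_norm ig) h_bound.
have iM n := integrable_max_partial_sum n.
have iMth n : P.-integrable setT (EFin \o (M n \o th)).
  exact/integrable_preserving/iM.
(* Preservation turns the integral of M_n o th into that of M_n, and M_n <= M_{n+1}. *)
have h0 n : 0 <= \int[P]_x h n x.
  rewrite (RintegralB _ (iM n.+1) (iMth n))//.
  rewrite Rintegral_preserving; [|exact: measurable_max_partial_sum|exact: max_partial_sum_ge0].
  rewrite subr_ge0; apply: (le_Rintegral _ (iM n) (iM n.+1)) => //.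
  by move=> x _; exact: max_partial_sum_le.
rewrite fine_ge0//; apply: (cvge_ge _ cv); apply: nearW => n.
rewrite -[leRHS]fineK ?lee_fin; first exact: h0.
apply: integrable_fin_num => //; apply: eq_integrable (integrableB _ (iM n.+1) (iMth n)) => //.
Qed.

End maximal_function.
Hypothesis th_ergodic : forall A, measurable A -> th @^-1` A = A ->
  P A = 0%E \/ P A = 1%E.

(** The invariant event [unbounded_sums g] has probability 0 or 1, and probability 1 would make the
    integral of [g] nonnegative. *)
Lemma ae_partial_sums_bounded (g : T -> R) :
  P.-integrable setT (EFin \o g) -> \int[P]_x g x < 0 ->
  {ae P, forall x, exists K, forall n, \sum_(j < n) g (iter j th x) <= K}.
Proof.
move=> ig g_lt0; have mU := measurable_unbounded_sums ig.
have [P0|P1] := th_ergodic mU (unbounded_sums_invariant g); last first.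
  by have := integral_ge0_of_unbounded_sums ig P1; rewrite leNgt g_lt0.
exists (unbounded_sums g); split => // x /=; apply: contra_notP.
move=> /existsNP[K]; rewrite -forallNP => hK; exists K%:R => n.
by apply: le_trans (partial_sum_le_max g n x) _; rewrite leNgt; apply/negP.
Qed.

(** The function f - (m + e/2) has mean -e/2 < 0, so its partial sums stay below some K. Hence the
    average is at most m + e/2 + K/n, and K/n <= e/2 for large n. *)
Lemma ae_average_bounded_above (f : T -> R) (e : R) :
  P.-integrable setT (EFin \o f) -> 0 < e ->
  {ae P, forall x, \forall n \near \oo,
    n%:R^-1 * \sum_(j < n) f (iter j th x) <= \int[P]_x f x + e}.
Proof.
move=> intf e0; set m := \int[P]_x f x.
have ic : P.-integrable setT (EFin \o cst (m + e / 2)).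
  exact: finite_measure_integrable_cst.
have ig : P.-integrable setT (EFin \o (f \- cst (m + e / 2))).
  by apply: eq_integrable (integrableB _ intf ic).
have g0 : \int[P]_x (f \- cst (m + e / 2)) x < 0.
  rewrite RintegralB// Rintegral_cst// [fine _](_ : _ = 1); last first.
    exact: (congr1 fine (probability_setT P)).
  by rewrite -/m; lra.
apply: filterS (ae_partial_sums_bounded ig g0) => x [K hK].
near=> n.
have n0 : 0 < n%:R :> R by rewrite ltr0n; near: n; exists 1%N.
rewrite ler_pdivrMl//; have := hK n; rewrite sumrB sumr_const card_ord.
have : K <= n%:R * (e / 2).
  rewrite -ler_pdivrMr ?divr_gt0//; near: n; exact: nbhs_infty_ger.
by rewrite -[_ *+ n]mulr_natl; nra.
Unshelve. all: end_near. Qed.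

(** The one-sided bound is applied to f and to -f. Only the tolerances 1/(k+1) are used, so that
    countably many null sets are discarded. *)
Theorem pointwise_ergodic (f : T -> R) : P.-integrable setT (EFin \o f) ->
  {ae P, forall x, n%:R^-1 * \sum_(j < n) f (iter j th x) @[n --> \oo] -->
    \int[P]_x f x}.
Proof.
move=> intf.
have intNf : P.-integrable setT (EFin \o (fun x => - f x)).
  exact: (integrableN intf).
have dist_le (m S r e : R) : - S <= - m + r -> S <= m + r -> r < e -> `|m - S| <= e.
  by move=> h1 h2 re; rewrite ler_norml; apply/andP; split; lra.
have e_gt0 k : 0 < k.+1%:R^-1 :> R by [].
have up := ae_foralln (fun k => ae_average_bounded_above intf (e_gt0 k)).
have lo := ae_foralln (fun k => ae_average_bounded_above intNf (e_gt0 k)).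
apply: filterS2 up lo => x up lo; apply/cvgrPdist_le => /= e e0.
have [k] := ltr_add_invr e0; rewrite add0r => ke; near=> n.
have : n%:R^-1 * \sum_(j < n) f (iter j th x) <= \int[P]_x f x + k.+1%:R^-1.
  by near: n; exact: up.
have : n%:R^-1 * \sum_(j < n) - f (iter j th x) <=
    \int[P]_x (- f x) + k.+1%:R^-1.
  by near: n; exact: lo.
have -> : \int[P]_x (- f x) = - \int[P]_x f x.
  by rewrite -[RHS]mulN1r -RintegralZl//; apply: eq_Rintegral => y _; rewrite mulN1r.
rewrite sumrN mulrN => h1 h2; refine (dist_le _ _ _ _ h1 h2 ke).
Unshelve. all: end_near. Qed.

End pointwise_ergodic_theorem.

(** * Transfer from the path space to a stationary ergodic process *)

Lemma ae_distribution (d d' : measure_display) (T : measurableType d)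
  (E : measurableType d') (R : realType) (P : probability T R)
  (U : {mfun T >-> E}) (Q : E -> Prop) :
  {ae distribution P U, forall x, Q x} -> {ae P, forall w, Q (U w)}.
Proof.
move=> [N [mN N0 QN]]; exists (U @^-1` N); split => //.
- exact: measurable_funPTI.
- by move=> w /= nQ; exact: QN.
Qed.

Section stationary_ergodic_process.
Context {d d' : measure_display} {T : measurableType d} {E : measurableType d'}
  {R : realType} (P : probability T R).

Lemma same_law_integrable (U V : {mfun T >-> E}) (f : E -> R) :
  same_law P U V -> measurable_fun setT f ->
  P.-integrable setT (EFin \o (f \o U)) -> P.-integrable setT (EFin \o (f \o V)).
Proof.
move=> UV mf /integrableP[_ intf]; apply/integrableP; split.
  by apply/measurable_EFinP; exact: measurableT_comp.
apply: le_lt_trans intf.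
have mnf : measurable_fun setT (abse \o (EFin \o f)).
  by apply: measurableT_comp => //; exact/measurable_EFinP.
rewrite -(@ge0_integral_distribution _ _ T E R P U _ mnf) => [|y]; last exact: abse_ge0.
rewrite -(@ge0_integral_distribution _ _ T E R P V _ mnf) => [|y]; last exact: abse_ge0.
rewrite le_eqVlt; apply/orP; left; apply/eqP.
by apply: eq_measure_integral => A mA _; exact/esym/UV.
Qed.

Lemma same_law_Rintegral (U V : {mfun T >-> E}) (f : E -> R) :
  same_law P U V -> measurable_fun setT f ->
  P.-integrable setT (EFin \o (f \o U)) ->
  \int[P]_w f (V w) = \int[P]_w f (U w).
Proof.
move=> UV mf intf; congr fine.
have mEf : measurable_fun setT (EFin \o f) by exact/measurable_EFinP.
rewrite -(@integral_distribution _ _ T E R P U _ mEf)//.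
rewrite -(@integral_distribution _ _ T E R P V _ mEf); last exact: (same_law_integrable UV).
by apply: eq_measure_integral => A mA _; exact/esym/UV.
Qed.

(** The generating family is the one in [path_measurable], so measurable sets of [path] are exactly
    the sets to which [stationary] and [ergodic] refer. *)
Local Notation path := (g_sigma_algebraType (\bigcup_(i in [set: nat])
    preimage_set_system setT (fun x : nat -> E => x i) measurable)).

Lemma measurable_coordinate i : measurable_fun setT (fun x : path => x i).
Proof.
move=> _ B mB; rewrite setTI; apply: sub_gen_smallest.
by exists i => //; exists B => //; rewrite setTI.
Qed.

Lemma measurable_path (d1 : measure_display) (S : measurableType d1)
  (h : S -> path) : (forall i, measurable_fun setT (fun w => h w i)) ->
  measurable_fun setT h.
Proof.
move=> mh; apply: (@measurability _ _ S path setT h _ erefl) => _ [_ [i _ [B mB <-]] <-].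
have := mh i measurableT B mB; rewrite !setTI; exact.
Qed.

Lemma measurable_sample_path (Z : nat -> {mfun T >-> E}) :
  measurable_fun setT (sample_path (fun i => Z i) : T -> path).
Proof. by apply: measurable_path => i; exact: measurable_funPT. Qed.

Lemma measurable_shift h : measurable_fun setT (@Defs.shift _ E h : path -> path).
Proof. by apply: measurable_path => i; exact: measurable_coordinate. Qed.

(** Under the law of the sample path, the one-step shift is measure preserving and ergodic.
    Birkhoff's theorem is applied to F(x) = f(x_0), whose value after j shifts is f(x_j), and the
    result is pulled back along the sample path. *)
Theorem stationary_ergodic_average (Z : nat -> {mfun T >-> E}) (f : E -> R) :
  stationary P (fun i => Z i) -> ergodic P (fun i => Z i) ->
  measurable_fun setT f -> P.-integrable setT (EFin \o (f \o Z 0%N)) ->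
  {ae P, forall w, n%:R^-1 * \sum_(j < n) f (Z j w) @[n --> \oo] -->
    \int[P]_w f (Z 0%N w)}.
Proof.
move=> stZ ergZ mf intf.
pose U : {mfun T >-> path} := HB.pack (sample_path (fun i => Z i) : T -> path)
  (isMeasurableFun.Build _ _ _ _ _ (measurable_sample_path Z)).
pose th : {mfun path >-> path} := HB.pack (@Defs.shift _ E 1 : path -> path)
  (isMeasurableFun.Build _ _ _ _ _ (measurable_shift 1)).
pose F (x : path) := f (x 0%N).
have mF : measurable_fun setT F.
  by apply: measurableT_comp => //; exact: measurable_coordinate.
have mEF : measurable_fun setT (EFin \o F) by exact/measurable_EFinP.
have intF : (distribution P U).-integrable setT (EFin \o F).
  exact: (@integrable_pushforward _ _ T path R U (measurable_sample_path Z) P setT _ mEF).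
have iterE j (x : path) : F (iter j th x) = f (x j).
  rewrite /F; suff -> : iter j th x = Defs.shift j x by [].
  elim: j => [|j IH]; first by apply/funext => i; rewrite /Defs.shift addn0.
  by rewrite iterS IH; apply/funext => i; rewrite /= /Defs.shift -addnA add1n.
have th_pres A : measurable A ->
    distribution P U (th @^-1` A) = distribution P U A.
  exact: stZ.
have th_erg A : measurable A -> th @^-1` A = A ->
    distribution P U A = 0%E \/ distribution P U A = 1%E.
  exact: ergZ.
have /ae_distribution := @pointwise_ergodic _ path R (distribution P U) th
  th_pres th_erg F intF.
apply: filterS => w; rewrite /Rintegral.
rewrite (@integral_distribution _ _ T path R P U _ mEF)//.
by under eq_fun do under eq_bigr do rewrite iterE.
Qed.

End stationary_ergodic_process.

(** * Trigonometric bounds and Borel measurability *)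

Section trigonometric_bounds.
Context {R : realType}.
Implicit Types x y : R.

Lemma lipschitz1_of_derive (f df : R -> R) : (forall x, is_derive x 1 f (df x)) ->
  (forall x, `|df x| <= 1) -> forall x y, `|f x - f y| <= `|x - y|.
Proof.
move=> dfE df1 x y; wlog yx : x y / y <= x.
  move=> H; have [|/ltW xy] := leP y x; first exact: H.
  by rewrite distrC [leRHS]distrC; exact: H.
have [|c _ ->] := MVT_segment yx (fun z _ => dfE z).
  apply: continuous_subspaceT => z; apply: differentiable_continuous.
  by apply/derivable1_diffP; apply: ex_derive.
by rewrite normrM ler_piMl.
Qed.

Lemma dist_cos_le x y : `|cos x - cos y| <= `|x - y|.
Proof.
apply: (lipschitz1_of_derive (df := fun z => - sin z)) => z.
by rewrite normrN sin_max.
Qed.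

Lemma dist_sin_le x y : `|sin x - sin y| <= `|x - y|.
Proof. exact: (lipschitz1_of_derive _ (@cos_max R)). Qed.

(** The half-angle formula gives 1 - cos x = 2 sin(x/2)^2, and |sin(x/2)| <= |x/2|. The left side is
    |e^{ix} - 1|^2. *)
Lemma one_sub_cos_le x : 2 * (1 - cos x) <= x ^+ 2.
Proof.
have -> : cos x = 1 - 2 * sin (x / 2) ^+ 2.
  rewrite {1}(splitr x) cosD -!expr2; have := cos2Dsin2 (x / 2); lra.
have := dist_sin_le (x / 2) 0; rewrite sin0 !subr0 => h.
have : `|sin (x / 2)| ^+ 2 <= `|x / 2| ^+ 2 by rewrite lerXn2r ?nnegrE.
rewrite !real_normK ?num_real// exprMn; lra.
Qed.

End trigonometric_bounds.

Lemma dotvC (R : realType) n (u v : 'rV[R]_n) : dotv u v = dotv v u.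
Proof. by apply: eq_bigr => i _; rewrite mulrC. Qed.

Lemma dot0v (R : realType) n (z : 'rV[R]_n) : dotv 0 z = 0.
Proof. by apply: big1 => i _; rewrite mxE mul0r. Qed.

Section borel_measurability.
Context {R : realType} {n : nat}.

Lemma measurable_coord i :
  measurable_fun setT (fun z : borelRn R n => (z : 'rV[R]_n) 0 i).
Proof.
apply: (measurability _ (RGenOInfty.measurableE R)) => _ [_ [x ->] <-].
rewrite setTI; apply: sub_gen_smallest.
have /continuousP h := @coord_continuous R 1 n 0 i.
by apply: h; exact: rray_open.
Qed.

Lemma measurable_dotvr u : measurable_fun setT (fun z : borelRn R n => dotv u z).
Proof.
apply: measurable_sum => i; apply: measurable_funM; first exact: measurable_cst.
exact: measurable_coord.
Qed.

Lemma measurable_dotvl z : measurable_fun setT (fun u : borelRn R n => dotv u z).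
Proof.
apply: measurable_sum => i; apply: measurable_funM; last exact: measurable_cst.
exact: measurable_coord.
Qed.

(** The norm dual to the coordinatewise distance in which rational frequencies approximate real
    ones. *)
Definition l1norm (z : 'rV[R]_n) : R := \sum_(i < n) `|z 0 i|.

Lemma measurable_l1norm : measurable_fun setT (l1norm : borelRn R n -> R).
Proof.
by apply: measurable_sum => i; apply: measurableT_comp => //; exact: measurable_coord.
Qed.

Lemma l1norm_ge0 z : 0 <= l1norm z.
Proof. by apply: sumr_ge0. Qed.

Lemma dist_dotv_le (u v z : 'rV[R]_n) e : (forall i, `|u 0 i - v 0 i| <= e) ->
  `|dotv u z - dotv v z| <= e * l1norm z.
Proof.
move=> uv; rewrite /dotv -sumrB /l1norm mulr_sumr.
apply: le_trans (ler_norm_sum _ _ _) _; apply: ler_sum => i _.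
by rewrite -mulrBl normrM ler_wpM2r.
Qed.

End borel_measurability.

Lemma rational_point_near (R : realType) n (u : 'rV[R]_n) (e : R) : 0 < e ->
  exists v : 'rV[rat]_n, forall i, `|u 0 i - map_mx ratr v 0 i| <= e.
Proof.
move=> e0.
have approx i : exists r : rat, `|u 0 i - ratr r| <= e.
  have : u 0 i < u 0 i + e by rewrite ltrDl.
  move=> /rat_in_itvoo[r]; rewrite in_itv/= => /andP[h1 h2]; exists r.
  by rewrite ler0_norm; lra.
have [q hq] := choice approx.
by exists (\row_i q i) => i; rewrite !mxE.
Qed.

(** * Empirical averages at all frequencies *)

Lemma bounded_integrable (d : measure_display) (T : measurableType d)
    (R : realType) (P : probability T R) (f : T -> R) (K : R) : measurable_fun setT f ->
  (forall w, `|f w| <= K) -> P.-integrable setT (EFin \o f).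
Proof.
move=> mf fK; apply: measurable_bounded_integrable => //.
  exact: le_lt_trans (probability_le1 P measurableT) (ltry 1).
exists K; split; first exact: num_real.
by move=> M KM w _; apply: le_trans (fK w) (ltW KM).
Qed.

Section uniform_ergodic_averages.
Context {d : measure_display} {T : measurableType d} {R : realType}
  (P : probability T R) {n : nat} (Z : nat -> {mfun T >-> borelRn R n}).
Hypothesis Z_stationary : stationary P (fun i => Z i).
Hypothesis Z_ergodic : ergodic P (fun i => Z i).

(** Bounds the change of [phi (dotv u z)] when each coordinate of [u] moves by at most 1/(m+1): by 2
    because |phi| <= 1, by the other term because phi is 1-Lipschitz. The truncation makes it
    integrable without a moment assumption. *)
Definition truncated_l1norm (m : nat) (z : 'rV[R]_n) : R :=
  Num.min 2 (m.+1%:R^-1 * l1norm z).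

Lemma measurable_truncated_l1norm m :
  measurable_fun setT (truncated_l1norm m : borelRn R n -> R).
Proof.
apply: measurable_minr; first exact: measurable_cst.
by apply: measurable_funM; [exact: measurable_cst|exact: measurable_l1norm].
Qed.

Lemma truncated_l1norm_bound m z : `|truncated_l1norm m z| <= 2.
Proof.
rewrite ger0_norm ?ge_min ?lexx// le_min ler0n mulr_ge0//=; exact: l1norm_ge0.
Qed.

Lemma integrable_truncated_l1norm m :
  P.-integrable setT (EFin \o (truncated_l1norm m \o Z 0%N)).
Proof.
apply: (@bounded_integrable _ _ _ _ _ 2); last by move=> w; exact: truncated_l1norm_bound.
by apply: (@measurableT_comp _ _ _ _ (borelRn R n)) => //; exact: measurable_truncated_l1norm.
Qed.

(** Dominated convergence: the integrand tends to 0 pointwise and is at most 2. *)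
Lemma cvg_truncated_l1norm :
  \int[P]_w truncated_l1norm m (Z 0%N w) @[m --> \oo] --> 0.
Proof.
have mh m : measurable_fun setT (EFin \o (truncated_l1norm m \o Z 0%N)).
  by move/integrableP: (integrable_truncated_l1norm m) => [].
have h_cvg : {ae P, forall w, setT w ->
    (truncated_l1norm m (Z 0%N w))%:E @[m --> \oo] --> (cst 0%:E w : \bar R)}.
  apply: aeW => w _; apply: cvg_EFin; first exact: nearW.
  apply: (@squeeze_cvgr _ _ _ _ (cst 0) (fun m => m.+1%:R^-1 * l1norm (Z 0%N w))).
  - apply: nearW => m; rewrite le_min ler0n mulr_ge0 ?l1norm_ge0//=.
    by rewrite ge_min lexx orbT.
  - exact: cvg_cst.
  - rewrite -(mul0r (l1norm (Z 0%N w))); apply: cvgM; last exact: cvg_cst.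
    exact: cvg_harmonic.
have h_bound : {ae P, forall w m, setT w ->
    (`|(truncated_l1norm m (Z 0%N w))%:E| <= (EFin \o cst 2%R) w)%E}.
  by apply: aeW => w m _; rewrite lee_fin truncated_l1norm_bound.
have [_ _] := dominated_convergence measurableT mh (measurable_cst _) h_cvg
  (finite_measure_integrable_cst P 2 measurableT) h_bound.
rewrite integral0 => /fine_cvg; exact.
Qed.

(** The null set must not depend on [u]. It is collected from countably many rational frequencies
    and countably many truncations [m]; outside it the argument is a deterministic triangle
    inequality. *)
Theorem ergodic_averages_dotv (phi : R -> R) :
  (forall x, `|phi x| <= 1) -> (forall x y, `|phi x - phi y| <= `|x - y|) ->
  measurable_fun setT phi ->
  {ae P, forall w, forall u : 'rV[R]_n,
    N%:R^-1 * \sum_(j < N) phi (dotv u (Z j w)) @[N --> \oo] -->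
    \int[P]_w' phi (dotv u (Z 0%N w'))}.
Proof.
move=> phi1 phiL mphi.
pose avg (f : 'rV[R]_n -> R) w N := N%:R^-1 * \sum_(j < N) f (Z j w).
pose F (u : 'rV[R]_n) z := phi (dotv u z).
have mF u : measurable_fun setT (F u : borelRn R n -> R).
  by apply: measurableT_comp => //; exact: measurable_dotvr.
have iF u : P.-integrable setT (EFin \o (F u \o Z 0%N)).
  apply: (@bounded_integrable _ _ _ _ _ 1); last by move=> w; exact: phi1.
  exact: (@measurableT_comp _ _ _ _ (borelRn R n)).
have F_close (u v : 'rV[R]_n) (m : nat) : (forall i, `|u 0 i - v 0 i| <= m.+1%:R^-1) ->
    forall z, `|F u z - F v z| <= truncated_l1norm m z.
  move=> uv z; rewrite le_min; apply/andP; split.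
    apply: le_trans (ler_normB _ _) _.
    by have := phi1 (dotv u z); have := phi1 (dotv v z); rewrite /F; lra.
  exact: le_trans (phiL _ _) (dist_dotv_le _ uv).
(* An enumeration of the rational points. Codes that decode to nothing are sent to 0, itself a
   rational point. *)
pose pt k : 'rV[R]_n := if unpickle k is Some v then map_mx (ratr : rat -> R) v else 0.
have ae_pt := ae_foralln (fun k => stationary_ergodic_average Z_stationary
  Z_ergodic (mF (pt k)) (iF (pt k))).
have ae_tr := ae_foralln (fun m => stationary_ergodic_average Z_stationary
  Z_ergodic (measurable_truncated_l1norm m) (integrable_truncated_l1norm m)).
apply: filterS2 ae_pt ae_tr => w pt_cvg tr_cvg u.
apply/cvgrPdist_le => /= e e0.
(* The budget is four quarters: one for the two integrals at [u] and [v], one for the convergence at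
   [v], and two for the averages at [u] and [v], namely the mean of the truncated norm and the
   deviation of its average from that mean. *)
have e4 : 0 < e / 4 by lra.
have /cvgrPdist_le/(_ _ e4)[m _ /(_ m (leqnn m))] := cvg_truncated_l1norm.
rewrite sub0r normrN => /= Em.
have [k] : exists k, forall i, `|u 0 i - pt k 0 i| <= m.+1%:R^-1.
  have [//|v uv] := @rational_point_near R n u m.+1%:R^-1.
  by exists (pickle v); rewrite /pt pickleK.
move: (pt k) (pt_cvg k) => v v_cvg uv.
have Euv : `|\int[P]_w' F u (Z 0%N w') - \int[P]_w' F v (Z 0%N w')| <=
    \int[P]_w' truncated_l1norm m (Z 0%N w').
  rewrite -RintegralB//; last 2 first.
  - exact: iF.
  - exact: iF.
  have iB : P.-integrable setT (EFin \o (fun w' => F u (Z 0%N w') - F v (Z 0%N w'))).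
    exact: (integrableB _ (iF u) (iF v)).
  apply: le_trans (le_normr_Rintegral _ iB) _ => //.
  apply: le_Rintegral => //.
  - exact: integrable_norm iB.
  - exact: integrable_truncated_l1norm.
  - by move=> w' _; exact: F_close.
near=> N.
have Auv : `|avg (F u) w N - avg (F v) w N| <= avg (truncated_l1norm m) w N.
  rewrite /avg -mulrBr -sumrB normrM ger0_norm// ler_wpM2l//.
  apply: le_trans (ler_norm_sum _ _ _) _; apply: ler_sum => j _.
  exact: F_close.
have Av : `|\int[P]_w' F v (Z 0%N w') - avg (F v) w N| <= e / 4.
  by near: N; move/cvgrPdist_le: v_cvg; exact.
have At : `|\int[P]_w' truncated_l1norm m (Z 0%N w') -
    avg (truncated_l1norm m) w N| <= e / 4.
  by near: N; move/cvgrPdist_le: (tr_cvg m); exact.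
have arith (a b c x y z : R) : `|a - b| <= c -> `|x - y| <= z ->
    `|b - y| <= e / 4 -> `|c - z| <= e / 4 -> `|c| <= e / 4 -> `|a - x| <= e.
  rewrite !ler_norml => /andP[? ?] /andP[? ?] /andP[? ?] /andP[? ?] /andP[? ?].
  by apply/andP; split; lra.
exact: arith Euv Auv Av At Em.
Unshelve. all: end_near. Qed.

Corollary ergodic_averages_dotv_law (XY : {mfun T >-> borelRn R n}) (phi : R -> R) :
  same_law P XY (Z 0%N) ->
  (forall x, `|phi x| <= 1) -> (forall x y, `|phi x - phi y| <= `|x - y|) ->
  measurable_fun setT phi ->
  {ae P, forall w, forall u : 'rV[R]_n,
    N%:R^-1 * \sum_(j < N) phi (dotv u (Z j w)) @[N --> \oo] -->
    \int[P]_w' phi (dotv u (XY w'))}.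
Proof.
move=> law phi1 phiL mphi.
apply: filterS (ergodic_averages_dotv phi1 phiL mphi) => w cv u.
pose F (z : borelRn R n) := phi (dotv u z).
have mF : measurable_fun setT F.
  by apply: measurableT_comp => //; exact: measurable_dotvr.
have iF : P.-integrable setT (EFin \o (F \o XY)).
  apply: (@bounded_integrable _ _ _ _ _ 1); last by move=> w'; exact: phi1.
  exact: (@measurableT_comp _ _ _ _ (borelRn R n)).
have <- : \int[P]_w' F (Z 0%N w') = \int[P]_w' phi (dotv u (XY w')).
  exact: (same_law_Rintegral law mF iF).
exact: cv.
Qed.

End uniform_ergodic_averages.

(** * Bounds on empirical covariances *)

Section complex_modulus.
Context {R : realType}.
Local Notation normc := (@ComplexField.Normc.normc R).

Lemma normc_sqr (a b : R) : normc (Complex a b) ^+ 2 = a ^+ 2 + b ^+ 2.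
Proof. by rewrite /= sqr_sqrtr// addr_ge0 ?sqr_ge0. Qed.

Lemma normc_ge0 (z : R[i]) : 0 <= normc z.
Proof. by case: z => a b; exact: sqrtr_ge0. Qed.

Lemma normc_natV N : normc N%:R^-1 = N%:R^-1.
Proof.
rewrite ComplexField.Normc.normcV; congr _^-1.
apply: (etrans (normcMn (1 : Rcomplex R) N)).
by rewrite ComplexField.Normc.normc1.
Qed.

Lemma le_normc_sum N (F : 'I_N -> R[i]) :
  normc (\sum_(j < N) F j) <= \sum_(j < N) normc (F j).
Proof.
apply: (big_ind2 (fun x y => normc x <= y)) => //.
  by rewrite ComplexField.Normc.normc0.
move=> x1 x2 y1 y2 h1 h2; apply: le_trans (lerD h1 h2).
exact: le_normcD.
Qed.

Lemma expiD (x y : R) : expi (x + y) = expi x * expi y.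
Proof. by rewrite /expi cosD sinD; simpc; rewrite [X in Complex _ X]addrC. Qed.

Lemma normc_expiB1 (x : R) : normc (expi x - 1) ^+ 2 = 2 * (1 - cos x).
Proof.
rewrite (_ : expi x - 1 = Complex (cos x - 1) (sin x)); last first.
  by rewrite /expi; simpc.
rewrite normc_sqr; have := cos2Dsin2 x; lra.
Qed.

End complex_modulus.

Lemma sum_CauchySchwarz (R : realType) N (a b : 'I_N -> R) :
  (\sum_(j < N) a j * b j) ^+ 2 <=
  (\sum_(j < N) a j ^+ 2) * (\sum_(j < N) b j ^+ 2).
Proof.
elim: N a b => [|N IH] a b; first by rewrite !big_ord0 expr0n/= mulr0.
rewrite !big_ord_recr/=; have := IH (fun i => a (widen_ord (leqnSn N) i))
  (fun i => b (widen_ord (leqnSn N) i)).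
have : 0 <= \sum_(i < N) a (widen_ord (leqnSn N) i) ^+ 2.
  by apply: sumr_ge0 => i _; exact: sqr_ge0.
have : 0 <= \sum_(i < N) b (widen_ord (leqnSn N) i) ^+ 2.
  by apply: sumr_ge0 => i _; exact: sqr_ge0.
move: (\sum_(i < N) _ ^+ 2) (\sum_(i < N) _ * _) => B.
move: (\sum_(i < N) _ ^+ 2) => A S.
move: (a ord_max) (b ord_max) => x y B0 A0 SAB.
(* The cross term in the expansion of (S + xy)^2. Both sides are squared to avoid roots; then S^2 <=
   AB and (A y^2 - B x^2)^2 >= 0 suffice. *)
have cross : 2 * S * x * y <= A * y ^+ 2 + B * x ^+ 2.
  set W := A * y ^+ 2 + B * x ^+ 2.
  have W0 : 0 <= W by rewrite addr_ge0// mulr_ge0// sqr_ge0.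
  apply: le_trans (ler_norm _) _; rewrite -(ger0_norm W0) -ler_sqr ?nnegrE//.
  rewrite !real_normK ?num_real//.
  have : S ^+ 2 * (x * y) ^+ 2 <= A * B * (x * y) ^+ 2 by rewrite ler_wpM2r// sqr_ge0.
  have := sqr_ge0 (A * y ^+ 2 - B * x ^+ 2).
  have -> : (2 * S * x * y) ^+ 2 = 4 * (S ^+ 2 * (x * y) ^+ 2) by ring.
  have -> : W ^+ 2 = (A * y ^+ 2 - B * x ^+ 2) ^+ 2 + 4 * (A * B * (x * y) ^+ 2).
    by rewrite /W; ring.
  lra.
nra.
Qed.

Section empirical_covariance.
Context {R : realType}.
Local Notation normc := (@ComplexField.Normc.normc R).

(* Centering both factors at [1] does not change the empirical covariance. *)
Lemma normc_covariance_le N (e f : 'I_N -> R[i]) :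
  normc (N%:R^-1 * (\sum_(j < N) e j * f j) -
         (N%:R^-1 * \sum_(j < N) e j) * (N%:R^-1 * \sum_(j < N) f j)) ^+ 2 <=
  4 * (N%:R^-1 * \sum_(j < N) normc (e j - 1) ^+ 2) *
      (N%:R^-1 * \sum_(j < N) normc (f j - 1) ^+ 2).
Proof.
(* For [N = 0] all sums are empty and both sides vanish. Otherwise N is invertible, as the centering
   identity requires. *)
case: N e f => [|N] e f; first by rewrite !big_ord0 !mulr0 subr0 ComplexField.Normc.normc0 expr0n.
move: N.+1 (ltn0Sn N) e f => {}N N0 e f.
have NC : N%:R != 0 :> R[i] by rewrite pnatr_eq0 -lt0n.
have NR : N%:R != 0 :> R by rewrite pnatr_eq0 -lt0n.
set V := (V in normc V).
have VE : V = N%:R^-1 * (\sum_(j < N) (e j - 1) * (f j - 1)) -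
   (N%:R^-1 * \sum_(j < N) (e j - 1)) * (N%:R^-1 * \sum_(j < N) (f j - 1)).
  have -> : \sum_(j < N) (e j - 1) * (f j - 1) =
      \sum_(j < N) e j * f j - \sum_(j < N) e j - \sum_(j < N) f j + N%:R.
    rewrite -!sumrB -[N in N%:R]card_ord -sumr_const -big_split/=.
    by apply: eq_bigr => j _; ring.
  rewrite !sumrB !sumr_const card_ord /V; field.
  exact: NC.
pose a j := normc (e j - 1); pose b j := normc (f j - 1).
have V_le : normc V <= N%:R^-1 * (\sum_(j < N) a j * b j) +
   (N%:R^-1 * \sum_(j < N) a j) * (N%:R^-1 * \sum_(j < N) b j).
  rewrite VE; apply: le_trans (le_normcD _ _) _; rewrite normcN.
  rewrite !ComplexField.Normc.normcM !normc_natV.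
  apply: lerD.
    rewrite ler_wpM2l//; apply: le_trans (le_normc_sum _) _.
    by under eq_bigr do rewrite ComplexField.Normc.normcM.
  by apply: ler_pM; rewrite ?mulr_ge0 ?normc_ge0// ler_wpM2l// le_normc_sum.
have avg_sqr (c : 'I_N -> R) : (N%:R^-1 * \sum_(j < N) c j) ^+ 2 <=
    N%:R^-1 * \sum_(j < N) c j ^+ 2.
  have := sum_CauchySchwarz c (fun=> 1) => /=.
  under eq_bigr do rewrite mulr1.
  have -> : \sum_(j < N) (1 : R) ^+ 2 = N%:R.
    by rewrite expr1n sumr_const card_ord.
  move=> h; rewrite exprMn.
  apply: (@le_trans _ _ (N%:R^-1 ^+ 2 * ((\sum_(j < N) c j ^+ 2) * N%:R))).
    by rewrite ler_wpM2l// sqr_ge0.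
  rewrite le_eqVlt; apply/orP; left; apply/eqP; field; exact: NR.
have avg_mul : (N%:R^-1 * \sum_(j < N) a j * b j) ^+ 2 <=
    (N%:R^-1 * \sum_(j < N) a j ^+ 2) * (N%:R^-1 * \sum_(j < N) b j ^+ 2).
  by rewrite [leRHS]mulrACA -[_ * _^-1]expr2 exprMn ler_wpM2l ?sqr_ge0// sum_CauchySchwarz.
(* Both s^2 and (xy)^2 are at most AB, and (s + xy)^2 <= 2 s^2 + 2 (xy)^2; this is the origin of the
   factor 4. *)
have arith (v s x y A B : R) : 0 <= v -> v <= s + x * y -> s ^+ 2 <= A * B ->
    x ^+ 2 <= A -> y ^+ 2 <= B -> v ^+ 2 <= 4 * A * B.
  move=> v0 vs sAB xA yB.
  have xyAB : (x * y) ^+ 2 <= A * B by rewrite exprMn ler_pM ?sqr_ge0.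
  have : v ^+ 2 <= (s + x * y) ^+ 2 by rewrite lerXn2r ?nnegrE//; exact: le_trans vs.
  by have := sqr_ge0 (s - x * y); nra.
exact: arith (normc_ge0 _) V_le avg_mul (avg_sqr a) (avg_sqr b).
Qed.

(** The left side never exceeds 4, which settles the cases r^alpha >= 1 and r rho >= 1. If r rho <
    1, it is at most (r rho)^2 <= (r rho)^alpha because alpha <= 2. *)
Lemma one_sub_cos_powR_le (alpha r rho x : R) : 0 < alpha <= 2 -> 0 <= r ->
  0 <= rho -> `|x| <= r * rho ->
  2 * (1 - cos x) <= 4 * (Num.min 1 (r `^ alpha) * (1 + rho `^ alpha)).
Proof.
move=> /andP[a0 a2] r0 rho0 xr.
have ra := powR_ge0 r alpha; have pa := powR_ge0 rho alpha.
have cosx : 2 * (1 - cos x) <= 4 by have := cos_geN1 x; lra.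
have [r1|r1] := leP 1 (r `^ alpha); first by nra.
have [rho1|rho1] := leP 1 (r * rho).
  have : 1 `^ alpha <= (r * rho) `^ alpha.
    by rewrite ge0_ler_powR ?nnegrE ?mulr_ge0 ?(ltW a0).
  by rewrite powR1 powRM//; nra.
(* Comparing powers with different exponents needs a positive base, so r rho = 0 is treated
   apart. *)
have [rr0|rr0] := leP (r * rho) 0.
  have x0 : x = 0 by apply/eqP; rewrite -normr_le0 (le_trans xr).
  by rewrite x0 cos0; nra.
have : (r * rho) `^ 2 <= (r * rho) `^ alpha by rewrite ger_powR// rr0 ltW.
rewrite powRM// [X in _ <= X -> _]powRM// !powR_mulrn//.
have := one_sub_cos_le x.
have : `|x| ^+ 2 <= (r * rho) ^+ 2 by rewrite lerXn2r ?nnegrE// ltW.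
by rewrite real_normK ?num_real// exprMn; nra.
Qed.

Lemma enorm_ge0 n (s : 'rV[R]_n) : 0 <= enorm s.
Proof. exact: sqrtr_ge0. Qed.

Lemma dotv_le_enorm n (s t : 'rV[R]_n) : `|dotv s t| <= enorm s * enorm t.
Proof.
rewrite -ler_sqr ?nnegrE ?mulr_ge0 ?enorm_ge0// real_normK ?num_real//.
rewrite exprMn !sqr_sqrtr; last 2 first.
- by apply: sumr_ge0 => i _; exact: sqr_ge0.
- by apply: sumr_ge0 => i _; exact: sqr_ge0.
exact: sum_CauchySchwarz.
Qed.

Lemma average_expiB1_le (alpha : R) n N (x : nat -> 'rV[R]_n) (s : 'rV[R]_n) B :
  0 < alpha <= 2 ->
  N%:R^-1 * \sum_(j < N) enorm (x j) `^ alpha <= B ->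
  N%:R^-1 * \sum_(j < N) normc (expi (dotv s (x j)) - 1) ^+ 2 <=
  4 * (Num.min 1 (enorm s `^ alpha) * (1 + B)).
Proof.
move=> a02 xB.
have m0 : 0 <= Num.min 1 (enorm s `^ alpha) by rewrite le_min ler01 powR_ge0.
apply: (@le_trans _ _ (4 * (Num.min 1 (enorm s `^ alpha) *
    (1 + N%:R^-1 * \sum_(j < N) enorm (x j) `^ alpha)))); last first.
  by rewrite ler_wpM2l// ler_wpM2l// lerD2l.
apply: (@le_trans _ _ (N%:R^-1 * \sum_(j < N)
    4 * (Num.min 1 (enorm s `^ alpha) * (1 + enorm (x j) `^ alpha)))).
  rewrite ler_wpM2l// ler_sum// => j _; rewrite normc_expiB1.
  apply: one_sub_cos_powR_le => //; [exact: enorm_ge0|exact: enorm_ge0|].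
  exact: dotv_le_enorm.
rewrite -!mulr_sumr big_split/= sumr_const card_ord.
rewrite mulrCA ler_wpM2l// mulrCA ler_wpM2l// mulrDr lerD2r.
(* The average of the constant 1 is 1 for positive N and 0 for [N = 0], so at most 1 in either
   case. *)
by case: N {xB} => [|N]; rewrite ?mulr0n ?mulr0// mulVf// pnatr_eq0.
Qed.

Lemma average_expiB1_le4 n N (x : nat -> 'rV[R]_n) (s : 'rV[R]_n) :
  N%:R^-1 * \sum_(j < N) normc (expi (dotv s (x j)) - 1) ^+ 2 <= 4.
Proof.
apply: (@le_trans _ _ (N%:R^-1 * \sum_(j < N) 4)).
  rewrite ler_wpM2l// ler_sum// => j _; rewrite normc_expiB1.
  by have := cos_geN1 (dotv s (x j)); lra.
rewrite sumr_const card_ord -[4 *+ N]mulr_natr mulrCA.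
by case: N => [|N]; rewrite ?mulr0// mulVf ?mulr1// pnatr_eq0.
Qed.

Lemma normc_emp_covariance_le N p q (x : nat -> 'rV[R]_p) (y : nat -> 'rV[R]_q) s t :
  normc (emp_joint_charf N x y s t
    - emp_joint_charf N x y s 0 * emp_joint_charf N x y 0 t) ^+ 2 <=
  4 * (N%:R^-1 * \sum_(j < N) normc (expi (dotv s (x j)) - 1) ^+ 2) *
      (N%:R^-1 * \sum_(j < N) normc (expi (dotv t (y j)) - 1) ^+ 2).
Proof.
rewrite /emp_joint_charf.
under eq_bigr do rewrite expiD.
under [\sum_(j < N) expi (_ + dotv 0 _)]eq_bigr do rewrite dot0v addr0.
under [\sum_(j < N) expi (dotv 0 _ + _)]eq_bigr do rewrite dot0v add0r.
exact: normc_covariance_le.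
Qed.

End empirical_covariance.

(** * Empirical distance covariance *)

Section characteristic_function_coordinates.
Context {R : realType} {p q : nat}.

Lemma dotv_row_mx (s : 'rV[R]_p) (t : 'rV[R]_q) z :
  dotv (row_mx s t) z = dotv s (lsubmx z) + dotv t (rsubmx z).
Proof.
rewrite /dotv big_split_ord/=; congr (_ + _); apply: eq_bigr => i _.
  by rewrite row_mxEl mxE.
by rewrite row_mxEr mxE.
Qed.

(** Together with [emp_sin], the coordinates of the empirical characteristic function on R^{p+q}.
    The marginals are its values at (s, 0) and (0, t), so convergence at all frequencies of one
    process covers the joint and both marginal functions. *)
Definition emp_cos N (z : nat -> 'rV[R]_(p + q)) u : R :=
  N%:R^-1 * \sum_(j < N) cos (dotv u (z j)).

Definition emp_sin N (z : nat -> 'rV[R]_(p + q)) u : R :=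
  N%:R^-1 * \sum_(j < N) sin (dotv u (z j)).

Lemma emp_joint_charfE N (z : nat -> 'rV[R]_(p + q)) s t :
  emp_joint_charf N (fun i => lsubmx (z i)) (fun i => rsubmx (z i)) s t =
  Complex (emp_cos N z (row_mx s t)) (emp_sin N z (row_mx s t)).
Proof.
rewrite /emp_joint_charf /emp_cos /emp_sin.
under eq_bigr do rewrite -dotv_row_mx.
have -> : \sum_(j < N) expi (dotv (row_mx s t) (z j)) =
    Complex (\sum_(j < N) cos (dotv (row_mx s t) (z j)))
            (\sum_(j < N) sin (dotv (row_mx s t) (z j))).
  elim: N => [|N IH]; first by rewrite !big_ord0.
  by rewrite !big_ord_recr/= IH; simpc.
have -> : N%:R^-1 = Complex N%:R^-1 0 :> R[i].
  by rewrite -[RHS]/(real_complex R N%:R^-1) fmorphV rmorph_nat.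
by simpc.
Qed.

Context {d : measure_display} {T : measurableType d} (P : probability T R).
Variable XY : T -> 'rV[R]_(p + q).

Lemma joint_charfE s t :
  joint_charf P (fun w => lsubmx (XY w)) (fun w => rsubmx (XY w)) s t =
  Complex (\int[P]_w cos (dotv (row_mx s t) (XY w)))
          (\int[P]_w sin (dotv (row_mx s t) (XY w))).
Proof.
rewrite /joint_charf /Cexpectation unlock /=; congr Complex;
  by apply: eq_Rintegral => w _; rewrite dotv_row_mx.
Qed.

Lemma charfEl s : charf P (fun w => lsubmx (XY w)) s =
  Complex (\int[P]_w cos (dotv (row_mx s 0) (XY w)))
          (\int[P]_w sin (dotv (row_mx s 0) (XY w))).
Proof.
rewrite /charf /Cexpectation unlock /=; congr Complex;
  by apply: eq_Rintegral => w _; rewrite dotv_row_mx dot0v addr0.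
Qed.

Lemma charfEr t : charf P (fun w => rsubmx (XY w)) t =
  Complex (\int[P]_w cos (dotv (row_mx 0 t) (XY w)))
          (\int[P]_w sin (dotv (row_mx 0 t) (XY w))).
Proof.
rewrite /charf /Cexpectation unlock /=; congr Complex;
  by apply: eq_Rintegral => w _; rewrite dotv_row_mx dot0v add0r.
Qed.

End characteristic_function_coordinates.

(** * Dominated convergence along a fixed path *)

Section dominated_empirical_covariance.
Context {R : realType} {p q : nat}.
Variable mu : {measure set (borelRn R (p + q)) -> \bar R}.
Local Notation normc := (@ComplexField.Normc.normc R).

(** For phi = c + i s this is |phi(s,t) - phi(s,0) phi(0,t)|^2, expanded into real terms so that
    limits and measurability are those of real functions. *)
Definition sqr_cov (c s : 'rV[R]_(p + q) -> R) (st : 'rV[R]_(p + q)) : R :=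
  (c st - (c (row_mx (lsubmx st) 0) * c (row_mx 0 (rsubmx st))
           - s (row_mx (lsubmx st) 0) * s (row_mx 0 (rsubmx st)))) ^+ 2
  + (s st - (c (row_mx (lsubmx st) 0) * s (row_mx 0 (rsubmx st))
           + s (row_mx (lsubmx st) 0) * c (row_mx 0 (rsubmx st)))) ^+ 2.

Lemma normc_cov_sqr c s st :
  normc (Complex (c (row_mx (lsubmx st) (rsubmx st))) (s (row_mx (lsubmx st) (rsubmx st)))
  - Complex (c (row_mx (lsubmx st) 0)) (s (row_mx (lsubmx st) 0))
    * Complex (c (row_mx 0 (rsubmx st))) (s (row_mx 0 (rsubmx st)))) ^+ 2 = sqr_cov c s st.
Proof. by rewrite hsubmxK; exact: normc_sqr. Qed.

Lemma sqr_cov_ge0 c s st : 0 <= sqr_cov c s st.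
Proof. by rewrite addr_ge0// sqr_ge0. Qed.

Lemma cvg_sqr_cov (c_ s_ : nat -> 'rV[R]_(p + q) -> R) (c s : 'rV[R]_(p + q) -> R) st :
  (forall u, c_ N u @[N --> \oo] --> c u) ->
  (forall u, s_ N u @[N --> \oo] --> s u) ->
  sqr_cov (c_ N) (s_ N) st @[N --> \oo] --> sqr_cov c s st.
Proof.
move=> cc ss; rewrite /sqr_cov; under eq_fun do rewrite !expr2.
by rewrite !expr2; apply: cvgD; apply: cvgM; apply: cvgB => //;
  first [by apply: cvgB; apply: cvgM|by apply: cvgD; apply: cvgM].
Qed.

(** The projection is self-adjoint, so it can be moved onto the fixed vector [z], leaving a linear
    form in [st]. *)
Lemma measurable_lsubmx_dotv (z : 'rV[R]_(p + q)) : measurable_fun setT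
  (fun st : borelRn R (p + q) => dotv (row_mx (lsubmx (st : 'rV[R]_(p + q))) 0) z).
Proof.
rewrite (_ : (fun _ => _) = (fun st => dotv st (row_mx (lsubmx z) 0))).
  exact: measurable_dotvl.
apply/funext => st; rewrite dotv_row_mx [RHS]dotvC dotv_row_mx !dot0v !addr0.
exact: dotvC.
Qed.

Lemma measurable_rsubmx_dotv (z : 'rV[R]_(p + q)) : measurable_fun setT
  (fun st : borelRn R (p + q) => dotv (row_mx 0 (rsubmx (st : 'rV[R]_(p + q)))) z).
Proof.
rewrite (_ : (fun _ => _) = (fun st => dotv st (row_mx 0 (rsubmx z)))).
  exact: measurable_dotvl.
apply/funext => st; rewrite dotv_row_mx [RHS]dotvC dotv_row_mx !dot0v !add0r.
exact: dotvC.
Qed.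

Lemma measurable_emp_cov N (z : nat -> 'rV[R]_(p + q)) :
  measurable_fun setT (sqr_cov (emp_cos N z) (emp_sin N z) : borelRn R (p + q) -> R).
Proof.
have mavg (phi : R -> R) (F : nat -> borelRn R (p + q) -> R) : continuous phi ->
    (forall j, measurable_fun setT (F j)) ->
    measurable_fun setT (fun st => N%:R^-1 * \sum_(j < N) phi (F j st)).
  move=> cphi mF; apply: measurable_funM; first exact: measurable_cst.
  apply: measurable_sum => j; apply: measurableT_comp => //.
  exact: continuous_measurable_fun.
have := mavg _ _ (@continuous_cos R) (fun j => measurable_dotvl (z j)).
have := mavg _ _ (@continuous_sin R) (fun j => measurable_dotvl (z j)).
have := mavg _ _ (@continuous_cos R) (fun j => measurable_lsubmx_dotv (z j)).
have := mavg _ _ (@continuous_sin R) (fun j => measurable_lsubmx_dotv (z j)).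
have := mavg _ _ (@continuous_cos R) (fun j => measurable_rsubmx_dotv (z j)).
have := mavg _ _ (@continuous_sin R) (fun j => measurable_rsubmx_dotv (z j)).
move=> sr cr sl cl s c.
rewrite /sqr_cov; apply: measurable_funD; apply: measurable_funX; apply: measurable_funB => //;
  first [by apply: measurable_funB; apply: measurable_funM
        |by apply: measurable_funD; apply: measurable_funM].
Qed.

Lemma emp_dcovE N (z : nat -> 'rV[R]_(p + q)) :
  emp_dcov mu N (fun i => lsubmx (z i)) (fun i => rsubmx (z i)) =
  (\int[mu]_st (sqr_cov (emp_cos N z) (emp_sin N z) st)%:E)%E.
Proof. by apply: eq_integral => st _; rewrite !emp_joint_charfE normc_cov_sqr. Qed.

Lemma dcovE (d : measure_display) (T : measurableType d) (P : probability T R)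
    (XY : T -> 'rV[R]_(p + q)) :
  dcov mu P (fun w => lsubmx (XY w)) (fun w => rsubmx (XY w)) =
  (\int[mu]_st (sqr_cov (fun u => \int[P]_w cos (dotv u (XY w)))
                        (fun u => \int[P]_w sin (dotv u (XY w))) st)%:E)%E.
Proof. apply: eq_integral => st _; rewrite joint_charfE charfEl charfEr.
by rewrite -normc_cov_sqr. Qed.

Lemma dominated_emp_cov_cvg (z : nat -> 'rV[R]_(p + q))
    (c s : 'rV[R]_(p + q) -> R) (g : borelRn R (p + q) -> R) :
  (forall u, emp_cos N z u @[N --> \oo] --> c u) ->
  (forall u, emp_sin N z u @[N --> \oo] --> s u) ->
  mu.-integrable setT (EFin \o g) ->
  (forall N st, sqr_cov (emp_cos N z) (emp_sin N z) st <= g st) ->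
  (\int[mu]_st (sqr_cov (emp_cos N z) (emp_sin N z) st)%:E @[N --> \oo] -->
   \int[mu]_st (sqr_cov c s st)%:E)%E.
Proof.
move=> cc ss ig le_g.
have cv st : sqr_cov (emp_cos N z) (emp_sin N z) st @[N --> \oo] --> sqr_cov c s st.
  by apply: cvg_sqr_cov.
have mN N : measurable_fun setT (EFin \o (sqr_cov (emp_cos N z) (emp_sin N z)) :
    borelRn R (p + q) -> \bar R).
  by apply/measurable_EFinP; exact: measurable_emp_cov.
(* The limiting integrand is measurable as a pointwise limit of measurable functions. *)
have ml : measurable_fun setT (EFin \o (sqr_cov c s) : borelRn R (p + q) -> \bar R).
  apply/measurable_EFinP; apply: (@measurable_fun_cvg _ (borelRn R (p + q)) R
    setT (fun N => sqr_cov (emp_cos N z) (emp_sin N z))) => // N.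
  exact: measurable_emp_cov.
have cv_ae : {ae mu, forall st, setT st ->
    (sqr_cov (emp_cos N z) (emp_sin N z) st)%:E @[N --> \oo] --> (sqr_cov c s st)%:E}.
  by apply: aeW => st _; apply: cvg_EFin; [exact: nearW|exact: cv].
have bound_ae : {ae mu, forall st N, setT st ->
    (`|(sqr_cov (emp_cos N z) (emp_sin N z) st)%:E| <= (EFin \o g) st)%E}.
  by apply: aeW => st N _; rewrite lee_fin ger0_norm ?sqr_cov_ge0.
by have [] := dominated_convergence measurableT mN ml cv_ae ig bound_ae.
Qed.

End dominated_empirical_covariance.

(** * Dominating functions for the empirical integrand *)

Section domination.
Context {R : realType} {p q : nat}.

Lemma emp_cov_le N (z : nat -> 'rV[R]_(p + q)) st :
  sqr_cov (emp_cos N z) (emp_sin N z) st <=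
  4 * (N%:R^-1 * \sum_(j < N) ComplexField.Normc.normc
         (expi (dotv (lsubmx st) (lsubmx (z j))) - 1) ^+ 2)
    * (N%:R^-1 * \sum_(j < N) ComplexField.Normc.normc
         (expi (dotv (rsubmx st) (rsubmx (z j))) - 1) ^+ 2).
Proof.
have := normc_emp_covariance_le N (fun j => lsubmx (z j)) (fun j => rsubmx (z j))
  (lsubmx st) (rsubmx st).
by rewrite !emp_joint_charfE normc_cov_sqr.
Qed.

(** 64 = 4 * 4 * 4: the factor of the covariance bound and the bound 4 on each average of |e^{ix} -
    1|^2. *)
Lemma emp_cov_le64 N (z : nat -> 'rV[R]_(p + q)) st :
  sqr_cov (emp_cos N z) (emp_sin N z) st <= 64.
Proof.
apply: le_trans (emp_cov_le N z st) _.
have := average_expiB1_le4 N (fun j => lsubmx (z j)) (lsubmx st).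
have := average_expiB1_le4 N (fun j => rsubmx (z j)) (rsubmx st).
have : 0 <= N%:R^-1 * \sum_(j < N) ComplexField.Normc.normc
         (expi (dotv (lsubmx st) (lsubmx (z j))) - 1) ^+ 2.
  by rewrite mulr_ge0// sumr_ge0// => j _; exact: sqr_ge0.
have : 0 <= N%:R^-1 * \sum_(j < N) ComplexField.Normc.normc
         (expi (dotv (rsubmx st) (rsubmx (z j))) - 1) ^+ 2.
  by rewrite mulr_ge0// sumr_ge0// => j _; exact: sqr_ge0.
nra.
Qed.

Definition min_powR (alpha : R) n (s : 'rV[R]_n) := Num.min 1 (enorm s `^ alpha).

Lemma min_powR_ge0 alpha n (s : 'rV[R]_n) : 0 <= min_powR alpha s.
Proof. by rewrite le_min ler01 powR_ge0. Qed.

Lemma min_powR_le1 alpha n (s : 'rV[R]_n) : min_powR alpha s <= 1.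
Proof. by rewrite ge_min lexx. Qed.

Lemma emp_cov_le_min_powR (alpha Bx By : R) N (z : nat -> 'rV[R]_(p + q)) st :
  0 < alpha <= 2 ->
  N%:R^-1 * \sum_(j < N) enorm (lsubmx (z j)) `^ alpha <= Bx ->
  N%:R^-1 * \sum_(j < N) enorm (rsubmx (z j)) `^ alpha <= By ->
  sqr_cov (emp_cos N z) (emp_sin N z) st <=
  64 * (1 + Bx) * (1 + By) * (min_powR alpha (lsubmx st) * min_powR alpha (rsubmx st)).
Proof.
move=> a02 hx hy; apply: le_trans (emp_cov_le N z st) _.
have := average_expiB1_le (x := fun j => lsubmx (z j)) (lsubmx st) a02 hx.
have := average_expiB1_le (x := fun j => rsubmx (z j)) (rsubmx st) a02 hy.
have : 0 <= N%:R^-1 * \sum_(j < N) ComplexField.Normc.normc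
         (expi (dotv (lsubmx st) (lsubmx (z j))) - 1) ^+ 2.
  by rewrite mulr_ge0// sumr_ge0// => j _; exact: sqr_ge0.
have : 0 <= N%:R^-1 * \sum_(j < N) ComplexField.Normc.normc
         (expi (dotv (rsubmx st) (rsubmx (z j))) - 1) ^+ 2.
  by rewrite mulr_ge0// sumr_ge0// => j _; exact: sqr_ge0.
move: (_ * \sum_(j < N) _) => b; move: (_ * \sum_(j < N) _) => a b0 a0 bB aA.
rewrite -mulrA; apply: le_trans (_ : 4 * ((4 * (min_powR alpha (lsubmx st) * (1 + Bx))) *
  (4 * (min_powR alpha (rsubmx st) * (1 + By)))) <= _).
  by rewrite ler_wpM2l// ler_pM.
by rewrite le_eqVlt; apply/orP; left; apply/eqP; ring.
Qed.

Lemma le_enorm_lsubmx (st : 'rV[R]_(p + q)) : enorm (lsubmx st) <= enorm st.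
Proof.
rewrite ler_wsqrtr// big_split_ord/= -[leLHS]addr0 lerD//.
  by rewrite le_eqVlt; apply/orP; left; apply/eqP; apply: eq_bigr => i _; rewrite mxE.
by apply: sumr_ge0 => i _; exact: sqr_ge0.
Qed.

(** The second factor is at most 1, and |s| <= |(s,t)|. *)
Lemma min_powR_mul_le alpha (st : 'rV[R]_(p + q)) : 0 <= alpha ->
  min_powR alpha (lsubmx st) * min_powR alpha (rsubmx st) <= min_powR alpha st.
Proof.
move=> a0; apply: (@le_trans _ _ (min_powR alpha (lsubmx st))).
  by rewrite ler_piMr ?min_powR_ge0 ?min_powR_le1.
rewrite le_min min_powR_le1/= ge_min; apply/orP; right.
by rewrite ge0_ler_powR ?nnegrE ?enorm_ge0 ?le_enorm_lsubmx.
Qed.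

Lemma measurable_enorm (d : measure_display) (S : measurableType d) n (f : S -> 'rV[R]_n) :
  (forall i, measurable_fun setT (fun x => f x 0 i)) ->
  measurable_fun setT (fun x => enorm (f x)).
Proof.
move=> mf; rewrite /enorm; apply: (@measurableT_comp _ _ _ S R R Num.sqrt).
  by apply: continuous_measurable_fun; exact: sqrt_continuous.
by apply: measurable_sum => i; apply: measurable_funX.
Qed.

Lemma measurable_enorm_id : measurable_fun setT
  (fun st : borelRn R (p + q) => enorm (st : 'rV[R]_(p + q))).
Proof. by apply: measurable_enorm => i; exact: measurable_coord. Qed.

Lemma measurable_enorm_lsubmx : measurable_fun setT
  (fun st : borelRn R (p + q) => enorm (lsubmx (st : 'rV[R]_(p + q)))).
Proof.
apply: measurable_enorm => i; under eq_fun do rewrite mxE.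
exact: measurable_coord.
Qed.

Lemma measurable_enorm_rsubmx : measurable_fun setT
  (fun st : borelRn R (p + q) => enorm (rsubmx (st : 'rV[R]_(p + q)))).
Proof.
apply: measurable_enorm => i; under eq_fun do rewrite mxE.
exact: measurable_coord.
Qed.

End domination.

(** * Bounded empirical moments and the almost sure limit *)

Lemma ge0_lty_integrable (d : measure_display) (S : measurableType d) (R : realType)
    (mu : {measure set S -> \bar R}) (g : S -> R) :
  measurable_fun setT g -> (forall x, 0 <= g x) ->
  (\int[mu]_x (g x)%:E < +oo)%E -> mu.-integrable setT (EFin \o g).
Proof.
move=> mg g0 fin; apply/integrableP; split; first exact/measurable_EFinP.
by under eq_integral do rewrite /= ger0_norm//.
Qed.

(** Almost surely the averages converge to a finite limit, and a convergent sequence is bounded. The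
    bound depends on the path. *)
Lemma moment_average_bounded (R : realType) (d : measure_display) (T : measurableType d)
  (P : probability T R) n (Z : nat -> {mfun T >-> borelRn R n})
  (XY : {mfun T >-> borelRn R n}) (f : borelRn R n -> R) :
  stationary P (fun i => Z i) -> ergodic P (fun i => Z i) ->
  same_law P XY (Z 0%N) -> measurable_fun setT f -> (forall x, 0 <= f x) ->
  ('E_P[fun w => f (XY w)] < +oo)%E ->
  {ae P, forall w, exists B, forall N, N%:R^-1 * \sum_(j < N) f (Z j w) <= B}.
Proof.
move=> stZ ergZ law mf f0 fin.
have iXY : P.-integrable setT (EFin \o (f \o XY)).
  apply: ge0_lty_integrable; last by rewrite unlock in fin.
    exact: measurableT_comp.
  by move=> w /=.
have := stationary_ergodic_average stZ ergZ mf (same_law_integrable law mf iXY).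
apply: filterS => w cv.
have [B hB] : has_ubound (range (fun N => N%:R^-1 * \sum_(j < N) f (Z j w))).
  by apply/bounded_fun_has_ubound/cvg_seq_bounded/cvg_ex; eexists; exact: cv.
by exists B => N; apply: hB; exists N.
Qed.

(* Z i is (X_(i+1), Y_(i+1)) and XY is the generic element (X, Y). *)
Theorem theorem3p1 (R : realType) (d : measure_display) (T : measurableType d)
  (P : probability T R) (p q : nat)
  (Z : nat -> {RV P >-> borelRn R (p + q)})
  (Z_stationary : stationary P (fun i => Z i))
  (Z_ergodic : ergodic P (fun i => Z i))
  (XY : {RV P >-> borelRn R (p + q)})
  (XY_generic : forall i : nat, same_law P XY (Z i))
  (mu : {measure set (borelRn R (p + q)) -> \bar R})
  (mu_finite_off_axes : forall delta : R, 0 < delta ->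
    (mu [set st : 'rV[R]_(p + q) |
       (delta < Num.min (enorm (lsubmx st)) (enorm (rsubmx st)))%R] < +oo)%E) :
  let X : T -> 'rV[R]_p := fun w => lsubmx (XY w) in
  let Y : T -> 'rV[R]_q := fun w => rsubmx (XY w) in
  let finite_moments (alpha : R) : Prop :=
    ('E_P[fun w => (enorm (X w) `^ alpha)%R]
     + 'E_P[fun w => (enorm (Y w) `^ alpha)%R] < +oo)%E in
  [\/ (mu setT < +oo)%E,
      mu setT = +oo%E /\
      (exists alpha : R,
        [/\ 0 < alpha <= 2,
            (\int[mu]_st
               ((Num.min 1 (enorm (lsubmx st : 'rV[R]_p) `^ alpha)
                 * Num.min 1 (enorm (rsubmx st : 'rV[R]_q) `^ alpha))%R)%:E
             < +oo)%E
          & finite_moments alpha])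
    | (exists U : set 'rV[R]_(p + q), open_nbhs (0 : 'rV[R]_(p + q)) U /\ mu U = +oo%E) /\
      (exists alpha : R,
        [/\ 0 < alpha <= 2,
            finite_moments alpha
          & (\int[mu]_st
               ((Num.min 1 (enorm (st : 'rV[R]_(p + q)) `^ alpha))%R)%:E
             < +oo)%E])] ->
  {ae P, forall w,
    emp_dcov mu n (fun i => lsubmx (Z i w)) (fun i => rsubmx (Z i w))
      @[n --> \oo] --> dcov mu P X Y}.
Proof.
move=> X Y finite_moments cases.
have law0 := XY_generic 0%N.
have mom (f : borelRn R (p + q) -> R) : measurable_fun setT f -> (forall x, 0 <= f x) ->
    ('E_P[fun w => f (XY w)] < +oo)%E ->
    {ae P, forall w, exists B, forall N, N%:R^-1 * \sum_(j < N) f (Z j w) <= B}.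
  exact: moment_average_bounded.
have cos_cvg := ergodic_averages_dotv_law Z_stationary Z_ergodic law0 (@cos_max R)
  (@dist_cos_le R) (continuous_measurable_fun (@continuous_cos R)).
have sin_cvg := ergodic_averages_dotv_law Z_stationary Z_ergodic law0 (@sin_max R)
  (@dist_sin_le R) (continuous_measurable_fun (@continuous_sin R)).
pose g alpha (st : borelRn R (p + q)) :=
  min_powR alpha (lsubmx st : 'rV[R]_p) * min_powR alpha (rsubmx st : 'rV[R]_q).
have mpow alpha (f : borelRn R (p + q) -> R) :
    measurable_fun setT f -> measurable_fun setT (fun st => f st `^ alpha).
  exact: (@measurableT_comp _ _ _ (borelRn R (p + q)) R R (@powR R ^~ alpha) setT f
    (@measurable_powR R alpha)).
have mmin alpha n (f : borelRn R (p + q) -> 'rV[R]_n) :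
    measurable_fun setT (fun st => enorm (f st)) ->
    measurable_fun setT (fun st => min_powR alpha (f st)).
  move=> mf; apply: measurable_minr; first exact: measurable_cst.
  exact: mpow.
have mg alpha : measurable_fun setT (g alpha).
  apply: measurable_funM; apply: mmin.
    exact: measurable_enorm_lsubmx.
  exact: measurable_enorm_rsubmx.
(* Common to conditions (2) and (3). The constants [Bx] and [By] vary with [w], which is harmless
   because dominated convergence in mu is used separately for each path. *)
have dominated_of_moments alpha : 0 < alpha <= 2 -> finite_moments alpha ->
    mu.-integrable setT (EFin \o g alpha) ->
    {ae P, forall w, exists h : borelRn R (p + q) -> R,
    mu.-integrable setT (EFin \o h) /\
    forall N st, sqr_cov (emp_cos N (fun i => Z i w)) (emp_sin N (fun i => Z i w)) st <= h st}.
  move=> a02 fin ig.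
  have EX0 : (0 <= 'E_P[fun w => (enorm (X w) `^ alpha)%R])%E.
    by apply: expectation_ge0 => w; exact: powR_ge0.
  have EY0 : (0 <= 'E_P[fun w => (enorm (Y w) `^ alpha)%R])%E.
    by apply: expectation_ge0 => w; exact: powR_ge0.
  have EX : ('E_P[fun w => (enorm (X w) `^ alpha)%R] < +oo)%E.
    by apply: le_lt_trans fin; rewrite leeDl.
  have EY : ('E_P[fun w => (enorm (Y w) `^ alpha)%R] < +oo)%E.
    by apply: le_lt_trans fin; rewrite leeDr.
  have bX := mom (fun z => enorm (lsubmx (z : 'rV[R]_(p + q))) `^ alpha)
    (mpow _ _ measurable_enorm_lsubmx)
    (fun z => powR_ge0 _ _) EX.
  have bY := mom (fun z => enorm (rsubmx (z : 'rV[R]_(p + q))) `^ alpha)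
    (mpow _ _ measurable_enorm_rsubmx)
    (fun z => powR_ge0 _ _) EY.
  apply: filterS2 bX bY => w [Bx hx] [By hy].
  exists (fun st => 64 * (1 + Bx) * (1 + By) * g alpha st); split.
    exact: (integrableZl measurableT (64 * (1 + Bx) * (1 + By)) ig).
  by move=> N st; exact: emp_cov_le_min_powR.
have dominated : {ae P, forall w, exists h : borelRn R (p + q) -> R,
    mu.-integrable setT (EFin \o h) /\
    forall N st, sqr_cov (emp_cos N (fun i => Z i w)) (emp_sin N (fun i => Z i w)) st <= h st}.
  (* Condition (1) is dominated by the constant 64, and condition (2) assumes integrability of the
     product weight. Under (3) that weight is integrable because it lies below min(1,
     |(s,t)|^alpha). *)
  case: cases => [mu_fin|[_ [alpha [a02 fin mom_fin]]]|[_ [alpha [a02 mom_fin fin]]]].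
  - apply: aeW => w; exists (cst 64); split.
      apply: (measurable_bounded_integrable measurableT mu_fin) => //.
      exists 64; split; first exact: num_real.
      by move=> M M64 st _ /=; rewrite normr_nat ltW.
    by move=> N st; exact: emp_cov_le64.
  - apply: (dominated_of_moments _ a02 mom_fin); apply: ge0_lty_integrable => //.
    by move=> st; rewrite mulr_ge0 ?min_powR_ge0.
  - apply: (dominated_of_moments _ a02 mom_fin).
    have a0 : 0 <= alpha by case/andP: a02 => /ltW.
    have ist : mu.-integrable setT (EFin \o
        (fun st : borelRn R (p + q) => min_powR alpha (st : 'rV[R]_(p + q)))).
      apply: ge0_lty_integrable => //; last by move=> st; exact: min_powR_ge0.
      exact: (mmin alpha _ (fun st => st : 'rV[R]_(p + q)) measurable_enorm_id).
    apply: le_integrable ist => //; first exact/measurable_EFinP.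
    move=> st _; rewrite lee_fin !ger0_norm ?min_powR_ge0 ?mulr_ge0 ?min_powR_ge0//.
    exact: min_powR_mul_le.
apply: filterS3 cos_cvg sin_cvg dominated => w cw sw [h [ih le_h]].
rewrite dcovE; under eq_fun do rewrite emp_dcovE.
exact: (dominated_emp_cov_cvg cw sw ih le_h).
Qed.
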